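(* Let $(G_n)_{n\ge 1}$ be a sequence of (possibly random, almost surely finite) graphs, let $o_n$ be a uniformly chosen vertex of $G_n$, and assume that $(d_{o_n})_{n\ge 1}$ is uniformly integrable. Let $(G,o)$ be a random connected locally finite rooted graph with law $\mu$ such that $\mu(d_o\ge 1)>0$, and assume that $G_n$ converges locally in probability to $(G,o)$. Then for every integer $k\ge 1$ such that $\mu(d_o=k)>0$, $$\Theta_{G_n}(k)\ \xrightarrow{\ \mathbb{P}\ }\ \mathbb{E}_\mu[F^*_\mu(d_V)\mid d_o=k]\qquad (n\to\infty),$$ where $V$ is a neighbour of $o$ in $G$ chosen uniformly at random and $$F^*_\mu(k)=\frac{\mathbb{E}_\mu[d_o\mathbf{1}_{\{d_o\le k\}}]}{\mathbb{E}_\mu[d_o]}.$$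
   Context: Graphs are simple and undirected; $d_v$ denotes the degree of vertex $v$. For a graph $G$, $\vec{E}(G)$ is the set of ordered pairs $(u,v)$ with $\{u,v\}\in E(G)$ (each undirected edge gives two directed edges), and $\sum_{u\to v}$ denotes summation over $(u,v)\in\vec{E}(G)$. Local convergence in probability: for a locally finite rooted graph $(G,o)$ and integer $r\ge 0$, $B_r^{(G)}(o)$ is the subgraph of $G$ induced by the vertices at graph distance at most $r$ from $o$, rooted at $o$; $\simeq$ denotes isomorphism of rooted graphs (a graph isomorphism mapping root to root). The sequence $G_n$ converges locally in probability to the random connected rooted graph $(G,o)$ with law $\mu$ if for every rooted graph $H_\star$ and every integer $r\ge 0$, $\frac{1}{|V(G_n)|}\sum_{v\in V(G_n)}\mathbf{1}_{\{B_r^{(G_n)}(v)\simeq H_\star\}}\to\mu(B_r^{(G)}(o)\simeq H_\star)$ in probability as $n\to\infty$. $\mathbb{E}_\mu$ is expectation over $(G,o)\sim\mu$ and over the uniform choice of the neighbour $V$. Uniform integrability is with respect to the joint randomness of $G_n$ and $o_n$. Average nearest neighbour rank (ANNR) of a finite graph $G$: let $f_G(k)=\frac{1}{|V(G)|}\sum_{v\in V(G)}\mathbf{1}_{\{d_v=k\}}$, $f^*_G(k)=\frac{1}{|\vec{E}(G)|}\sum_{u\to v}\mathbf{1}_{\{d_u=k\}}$, $h_G(k,\ell)=\frac{1}{|\vec{E}(G)|}\sum_{u\to v}\mathbf{1}_{\{d_u=k,\,d_v=\ell\}}$ and $F^*_G(k)=\frac{1}{|\vec{E}(G)|}\sum_{v\in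 V(G)}d_v\mathbf{1}_{\{d_v\le k\}}$. For $k=1,2,\dots$, $$\Theta_G(k)=\mathbf{1}_{\{f_G(k)>0\}}\frac{\sum_{\ell>0}F^*_G(\ell)\,h_G(k,\ell)}{f^*_G(k)},$$ interpreted as $0$ when $f_G(k)=0$. *)

(* Defs.v *)
From HB Require Import structures.
From mathcomp Require Import all_boot all_order all_algebra.
From mathcomp Require Import finmap.
From mathcomp Require Import all_classical all_reals all_analysis.
Set Implicit Arguments.
Unset Strict Implicit.
Unset Printing Implicit Defensive.
Import Order.TTheory GRing.Theory Num.Theory.
Import numFieldNormedType.Exports.
Local Open Scope classical_set_scope.
Local Open Scope ring_scope.

(* Simple undirected graphs, finite or infinite, on an arbitrary vertex type. *)
Record sgraph := SGraph {
  vertex :> choiceType;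
  adj : rel vertex;
  adj_sym : symmetric adj;
  adj_irr : irreflexive adj }.

Record rooted_graph := RootedGraph { ugraph :> sgraph; groot : ugraph }.

(* For an infinite set A, fset_set A is empty, so ncard A = 0: the cardinal is
   meaningful only where A is finite. *)
Definition ncard (T : choiceType) (A : set T) : nat := #|` fset_set A |.

Definition nbr (G : sgraph) (v : G) : set G := [set u | adj v u].

Definition deg (G : sgraph) (v : G) : nat := ncard (nbr v).

Definition dedges (G : sgraph) : set (G * G) := [set e | adj e.1 e.2].
Arguments dedges : clear implicits.

Definition graph_iso (G H : sgraph) : Prop :=
  exists2 f : G -> H, bijective f & {mono f : x y / adj x y}.

Definition rooted_iso (G H : rooted_graph) : Prop :=
  exists f : G -> H,
    [/\ bijective f, {mono f : x y / adj x y} & f (groot G) = groot H].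

(* The graph distance from u to v is at most r iff some walk u :: p from u to v
   has size p <= r edges. *)
Definition dist_le (G : sgraph) (r : nat) (u v : G) : Prop :=
  exists p : seq G, [/\ path (@adj G) u p, last u p = v & (size p <= r)%N].

Definition connected_graph (G : sgraph) : Prop :=
  forall u v : G, exists r, dist_le r u v.

Definition locally_finite (G : sgraph) : Prop :=
  forall v : G, finite_set (nbr v).

Section induced.
Variables (G : sgraph) (A : set G).

Definition induced_adj : rel A := fun x y => adj (val x) (val y).

Fact induced_adj_sym : symmetric induced_adj.
Proof. by move=> x y; exact: adj_sym. Qed.

Fact induced_adj_irr : irreflexive induced_adj.
Proof. by move=> x; exact: adj_irr. Qed.

Definition induced : sgraph := SGraph induced_adj_sym induced_adj_irr.
End induced.

Definition ball_set (G : sgraph) (r : nat) (o : G) : set G :=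
  [set v | dist_le r o v].

Fact root_in_ball (G : sgraph) (r : nat) (o : G) : o \in ball_set r o.
Proof. by apply/mem_set; exists [::]. Qed.

Definition gball (G : sgraph) (r : nat) (o : G) : rooted_graph :=
  @RootedGraph (induced (ball_set r o)) (exist _ o (root_in_ball r o)).

Section empirical.
Variable R : realType.

(* Averages over the vertices and over the directed edges of a finite graph.
   vavg G f is also the expectation of f at a uniform vertex of G. *)
Definition vavg (G : sgraph) (f : G -> R) : R :=
  (\sum_(v \in [set: G]) f v) / (ncard [set: G])%:R.

Definition eavg (G : sgraph) (f : G -> G -> R) : R :=
  (\sum_(e \in dedges G) f e.1 e.2) / (ncard (dedges G))%:R.

Definition deg_tail (G : sgraph) (K : nat) : R :=
  vavg (fun v : G => (deg v)%:R * (K < deg v)%N%:R).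

Definition fdeg (G : sgraph) (k : nat) : R :=
  vavg (fun v : G => (deg v == k)%:R).

Definition fstar (G : sgraph) (k : nat) : R :=
  eavg (fun u v : G => (deg u == k)%:R).

Definition hdeg (G : sgraph) (k l : nat) : R :=
  eavg (fun u v : G => ((deg u == k) && (deg v == l))%:R).

Definition Fstar (G : sgraph) (k : nat) : R :=
  (\sum_(v \in [set: G]) ((deg v)%:R * (deg v <= k)%N%:R : R))
  / (ncard (dedges G))%:R.

(* For a finite graph, hdeg G k l vanishes for all but finitely many l, so the
   sum over l has finite support. *)
Definition annr (G : sgraph) (k : nat) : R :=
  (0 < fdeg G k)%R%:R *
  ((\sum_(l \in [set l : nat | (0 < l)%N]) Fstar G l * hdeg G k l)
   / fstar G k).

End empirical.

(* Graphs carry no canonical sigma-algebra, since their vertex sets may vary;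
   a random finite graph is one whose isomorphism class is random, and a random
   rooted graph is one for which all the events of the local topology are
   measurable. *)
Definition random_graph d (T : measurableType d) (G : T -> sgraph) : Prop :=
  forall H : sgraph,
    finite_set [set: H] -> measurable [set w | graph_iso (G w) H].

Definition random_rooted_graph d (T : measurableType d)
    (G : T -> rooted_graph) : Prop :=
  forall (r : nat) (H : rooted_graph),
    measurable [set w | rooted_iso (gball r (groot (G w))) H].

Section convergence.
Variables (R : realType) (d : nat -> measure_display).
Variables (T : forall n, measurableType (d n)).
Variable (P : forall n, probability (T n) R).

Definition cvg_in_prob (X : forall n, T n -> R) (c : R) : Prop :=
  forall e : R, 0 < e ->
    P n [set w | e < `|X n w - c|] @[n --> \oo] --> 0%E.

(* Uniform integrability of the degrees of the uniform vertices o_n of G_n: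
   E [d_(o_n) ; d_(o_n) > K] tends to 0 as K tends to infinity, uniformly in n,
   the expectation being first over o_n given G_n (vavg) and then over G_n. *)
Definition deg_unif_integrable (G : forall n, T n -> sgraph) : Prop :=
  ereal_sup (range (fun n : nat => 'E_(P n)[fun w => deg_tail R (G n w) K]%E))
  @[K --> \oo] --> 0%E.

Definition local_cvg_in_prob (G : forall n, T n -> sgraph)
    d' (T' : measurableType d') (mu : probability T' R)
    (G' : T' -> rooted_graph) : Prop :=
  forall (r : nat) (H : rooted_graph),
    cvg_in_prob
      (fun n w => vavg (fun v : G n w => (`[< rooted_iso (gball r v) H >])%:R))
      (fine (mu [set w | rooted_iso (gball r (groot (G' w))) H])).

End convergence.

Section limit.
Variables (R : realType) (d : measure_display) (T : measurableType d).
Variables (mu : probability T R) (G : T -> rooted_graph).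

Definition deg_event (k : nat) : set T := [set w | deg (groot (G w)) = k].

(* Expectation conditionally on an event of positive probability. *)
Definition cond_expectation (X : T -> R) (A : set T) : R :=
  fine ('E_mu[fun w => (X w * \1_A w)%R])%E / fine (mu A).

Definition Fstar_mu (k : nat) : R :=
  fine ('E_mu[fun w =>
          ((deg (groot (G w)))%:R * (deg (groot (G w)) <= k)%N%:R)%R])%E
  / fine ('E_mu[fun w => (deg (groot (G w)))%:R%R])%E.

(* Mean of f over a uniformly chosen neighbour of v. *)
Definition nbr_mean (H : sgraph) (v : H) (f : H -> R) : R :=
  (\sum_(u \in nbr v) f u) / (deg v)%:R.

Definition annr_mu (k : nat) : R :=
  cond_expectation
    (fun w => nbr_mean (groot (G w)) (fun v => Fstar_mu (deg v)))
    (deg_event k).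

End limit.

(* Main.v *)
Require Import Defs.
From HB Require Import structures.
From mathcomp Require Import all_boot all_order all_algebra.
From mathcomp Require Import finmap lra.
From mathcomp Require Import all_classical all_reals all_analysis.
From mathcomp Require Import measurable_realfun.
Set Implicit Arguments.
Unset Strict Implicit.
Unset Printing Implicit Defensive.
Import Order.TTheory GRing.Theory Num.Theory.
Import numFieldNormedType.Exports.
Local Open Scope classical_set_scope.
Local Open Scope ring_scope.

(** For a finite graph with an edge and with [f_G k > 0], exchanging sums gives
    [Theta_G k = A / (k f_G k)], where [A] is the average over the vertices [v]
    of [1{d_v = k} \sum_(u ~ v) F*_G (d_u)]. Averages over the vertices of a
    bounded function of the ball of radius 2 converge in probability to the
    expectation of that function at [o]: such a function is approximated from
    below by finite combinations of indicators of isomorphism classes of finite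
    balls, which yields a lower bound for the limit, and the upper bound is the
    lower bound for the complementary function. Uniform integrability extends
    this to the mean degree, so that [F*_(G_n)] converges pointwise to [F*_mu];
    by monotonicity the convergence is uniform (Polya), and [F*_(G_n)] may be
    replaced by [F*_mu] in [A]. *)

(** * Isomorphism invariance *)

(** Infinite sets are covered as well: [ncard] is 0 there by convention, and the sum defaults to 0
    because its support, all of [A] since 1 is nonzero, is infinite. *)
Lemma ncardE (R : nzSemiRingType) (T : choiceType) (A : set T) :
  (ncard A)%:R = \sum_(x \in A) (1 : R).
Proof.
rewrite /ncard; have [fA|iA] := pselect (finite_set A).
  by rewrite fsbig_finite//= big_const_seq count_predT iter_addr_0.
rewrite fsbig_dflt.
  by rewrite /fset_set; case: pselect => // _; rewrite cardfs0.
rewrite (_ : A `&` _ = A)//; apply/seteqP; split => [x []//|x Ax].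
by split => //=; apply/eqP; exact: oner_neq0.
Qed.

Lemma ncard_bij (S T : choiceType) (A : set S) (B : set T) (f : S -> T) :
  set_bij A B f -> ncard A = ncard B.
Proof.
by move=> fAB; rewrite -[LHS]natn -[RHS]natn !ncardE (reindex_fsbig _ _ _ _ fAB).
Qed.

Lemma induced_nbr_bij (G : sgraph) (A : set G) (x : Defs.induced A) :
  nbr (val x) `<=` A -> set_bij (nbr x) (nbr (val x)) val.
Proof.
move=> xA; split=> [y //|y z _ _|u xu]; first exact: val_inj.
by exists (exist _ u (mem_set (xA u xu))).
Qed.

Section isomorphism.
Variables (G H : sgraph) (f : G -> H).
Hypotheses (f_bij : bijective f) (f_mono : {mono f : x y / adj x y}).

Lemma nbr_bij (v : G) : set_bij (nbr v) (nbr (f v)) f.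
Proof.
split=> [u vu|u w _ _|w vw]; first by rewrite /nbr/= f_mono.
  exact: (bij_inj f_bij).
have [g fK gK] := f_bij.
by exists (g w); rewrite ?gK//= /nbr/= -f_mono gK.
Qed.

Lemma deg_iso (v : G) : deg (f v) = deg v.
Proof. by rewrite /deg (ncard_bij (nbr_bij v)). Qed.

Lemma dedges_bij : set_bij (dedges G) (dedges H) (fun e => (f e.1, f e.2)).
Proof.
have [g fK gK] := f_bij.
split=> [e ee|[a b] [a' b'] _ _ /= [/(can_inj fK)-> /(can_inj fK)->]//|[a b] /= ab].
  by rewrite /dedges/= f_mono.
by exists (g a, g b); rewrite /= ?gK// /dedges/= -f_mono !gK.
Qed.

Lemma dist_le_iso r (u v : G) : dist_le r u v -> dist_le r (f u) (f v).
Proof.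
move=> [p [up <- pr]]; exists (map f p); split; rewrite ?size_map ?last_map//.
by rewrite path_map (eq_path (e' := @adj G)) // => x y /=; rewrite f_mono.
Qed.

Variable R : realType.

Lemma vavg_iso (F : G -> R) (F' : H -> R) :
  (forall v, F' (f v) = F v) -> vavg F' = vavg F.
Proof.
move=> FF'; rewrite /vavg (reindex_fsbigT _ _ f_bij).
rewrite (eq_fsbigr F); last by move=> v _; exact: FF'.
by congr (_ / _%:R); apply/esym/(@ncard_bij _ _ _ _ f); rewrite setTT_bijective.
Qed.

Lemma eavg_iso (F : G -> G -> R) (F' : H -> H -> R) :
  (forall u v, F' (f u) (f v) = F u v) -> eavg F' = eavg F.
Proof.
move=> FF'; rewrite /eavg (reindex_fsbig _ _ _ _ dedges_bij).
rewrite (eq_fsbigr (fun e => F e.1 e.2)); last by move=> v _; exact: FF'.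
by congr (_ / _%:R); apply/esym/(ncard_bij dedges_bij).
Qed.

Lemma fdeg_iso k : fdeg R H k = fdeg R G k.
Proof. by apply: vavg_iso => v; rewrite deg_iso. Qed.

Lemma deg_tail_iso k : deg_tail R H k = deg_tail R G k.
Proof. by apply: vavg_iso => v; rewrite deg_iso. Qed.

Lemma annr_iso k : annr R H k = annr R G k.
Proof.
rewrite /annr fdeg_iso; congr (_ * (_ / _)).
  apply: eq_fsbigr => l _; congr (_ * _).
    rewrite /Fstar (reindex_fsbigT _ _ f_bij) -(ncard_bij dedges_bij).
    by congr (_ / _); apply: eq_fsbigr => v _; rewrite deg_iso.
  by apply: eavg_iso => u v; rewrite !deg_iso.
by apply: eavg_iso => u v; rewrite !deg_iso.
Qed.

End isomorphism.

Lemma rooted_iso_trans H1 H2 H3 :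
  rooted_iso H1 H2 -> rooted_iso H2 H3 -> rooted_iso H1 H3.
Proof.
move=> [f [fb fm fr]] [g [gb gm gr]]; exists (g \o f); split.
- exact: bij_comp.
- by move=> x y /=; rewrite gm fm.
- by rewrite /= fr gr.
Qed.

Lemma rooted_iso_sym H1 H2 : rooted_iso H1 H2 -> rooted_iso H2 H1.
Proof.
move=> [f [[g fK gK] fm fr]]; exists g; split.
- by exists f.
- by move=> x y; rewrite -fm !gK.
- by rewrite -fr fK.
Qed.

Lemma gball_iso (G H : sgraph) (f : G -> H) (r : nat) (v : G) :
  bijective f -> {mono f : x y / adj x y} ->
  rooted_iso (gball r v) (gball r (f v)).
Proof.
move=> f_bij fm; have [g fK gK] := f_bij.
have gm : {mono g : x y / adj x y} by move=> x y; rewrite -fm !gK.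
have g_bij : bijective g by exists f.
have fP (x : ball_set r v) : f (val x) \in ball_set r (f v).
  by apply/mem_set/dist_le_iso => //; exact/set_mem/(valP x).
have gP (y : ball_set r (f v)) : g (val y) \in ball_set r v.
  have /set_mem/(dist_le_iso gm) := valP y.
  by rewrite fK => ?; exact/mem_set.
exists (fun x : gball r v => exist _ (f (val x)) (fP x) : gball r (f v)); split.
- exists (fun y : gball r (f v) => exist _ (g (val y)) (gP y) : gball r v).
    by move=> x; apply: val_inj; exact: fK.
  by move=> x; apply: val_inj; exact: gK.
- by move=> x y; exact: fm.
- exact: val_inj.
Qed.

Lemma gball_root_nbr (G : sgraph) r (o : G) :
  set_bij (nbr (groot (gball r.+1 o))) (nbr o) val.
Proof.
apply: (@induced_nbr_bij G (ball_set r.+1 o)) => u ou.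
by exists [:: u]; split; rewrite //= andbT.
Qed.

(** Every neighbour of a neighbour of [o] lies within distance 2 of [o], so passing to the induced
    ball loses none of them. This is why balls of radius 2 determine the degrees of the neighbours
    of the root. *)
Lemma gball_nbr_nbr (G : sgraph) r (o : G) (x : gball r.+2 o) :
  nbr (groot (gball r.+2 o)) x -> set_bij (nbr x) (nbr (val x)) val.
Proof.
move=> ox; apply: (@induced_nbr_bij G (ball_set r.+2 o)) => u xu.
by exists [:: val x; u]; split; rewrite //= andbT; apply/andP.
Qed.

Lemma deg_gball_root (G : sgraph) r (o : G) :
  deg (groot (gball r.+1 o)) = deg o.
Proof. exact/ncard_bij/gball_root_nbr. Qed.

Lemma sum_nbr_gball (R : nmodType) (G : sgraph) r (o : G) (F : nat -> R) :
  \sum_(u \in nbr (groot (gball r.+2 o))) F (deg u) = \sum_(u \in nbr o) F (deg u).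
Proof.
rewrite (reindex_fsbig _ _ _ _ (gball_root_nbr r.+1 o)); apply: eq_fsbigr => x.
by move=> /set_mem ox; rewrite /deg (ncard_bij (gball_nbr_nbr ox)).
Qed.

(** * Finite graphs *)

(** Nonemptiness keeps the denominator of [vavg] positive, so that constants average to
    themselves. *)
Definition finite_graph (G : sgraph) :=
  finite_set [set: G] /\ [set: G] !=set0.

Lemma ncard_not_finite_graph (H : sgraph) :
  ~ finite_graph H -> ncard [set: H] = 0%N.
Proof.
move=> nH; rewrite /ncard; have [fH|iH] := pselect (finite_set [set: H]).
  apply/eqP; rewrite cardfs_eq0; apply/eqP/fsetP => v; rewrite inE; apply/negP => _.
  by apply: nH; split => //; exists v.
by rewrite /fset_set; case: pselect => // _; rewrite cardfs0.
Qed.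

Lemma vavg_not_finite_graph (R : realType) (H : sgraph) (F : H -> R) :
  ~ finite_graph H -> vavg F = 0.
Proof. by move=> nH; rewrite /vavg ncard_not_finite_graph// invr0 mulr0. Qed.

Lemma deg_tail_ge0 (R : realType) (G : sgraph) K : 0 <= deg_tail R G K.
Proof.
by rewrite /deg_tail /vavg divr_ge0 ?ler0n// fsumr_ge0// => v _; rewrite mulr_ge0.
Qed.

Section finite_graphs.
Variables (R : realType) (G : sgraph).
Hypothesis G_fin : finite_graph G.
Implicit Types f g : G -> R.

Lemma finite_subgraph (A : set G) : finite_set A.
Proof. by have [fG _] := G_fin; exact: sub_finite_set fG. Qed.

Lemma ncard_vertices_gt0 : (0 < ncard [set: G])%N.
Proof.
have [fG [v _]] := G_fin; rewrite /ncard cardfs_gt0; apply/fset0Pn; exists v.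
by rewrite in_fset_set// inE.
Qed.

Let N_gt0 : 0 < (ncard [set: G])%:R :> R.
Proof. by rewrite ltr0n ncard_vertices_gt0. Qed.

Lemma vavgD f g : vavg (fun v => f v + g v) = vavg f + vavg g.
Proof. by rewrite /vavg fsbig_split ?mulrDl//; have [] := G_fin. Qed.

Lemma vavgZ (c : R) f : vavg (fun v => c * f v) = c * vavg f.
Proof. by rewrite /vavg -mulr_fsumr mulrA. Qed.

Lemma vavg_cst (c : R) : vavg (fun _ : G => c) = c.
Proof.
rewrite /vavg -[X in \sum_(_ \in _) X](mulr1 c) -mulr_fsumr -ncardE mulfK//.
by rewrite gt_eqF.
Qed.

Lemma ler_vavg f g : (forall v, f v <= g v) -> vavg f <= vavg g.
Proof.
move=> fg; rewrite ler_wpM2r ?invr_ge0 ?(ltW N_gt0)//.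
by have [fG _] := G_fin; rewrite !fsbig_finite// ler_sum.
Qed.

Lemma vavg_norm_le f (C : R) : (forall v, `|f v| <= C) -> `|vavg f| <= C.
Proof.
move=> fC; rewrite ler_norml -[in X in X && _](vavg_cst (- C)).
rewrite -[in X in _ && X](vavg_cst C).
by apply/andP; split; apply: ler_vavg => v; have := fC v; rewrite ler_norml => /andP[].
Qed.

Lemma vavg_sum n (F : 'I_n -> G -> R) :
  vavg (fun v => \sum_(i < n) F i v) = \sum_(i < n) vavg (F i).
Proof.
elim: n => [|n IHn] in F *.
  rewrite big_ord0 -[RHS](vavg_cst 0).
  by congr vavg; apply/funext => v; rewrite big_ord0.
rewrite big_ord_recr/= -IHn -vavgD.
by congr vavg; apply/funext => v; rewrite big_ord_recr.
Qed.

Lemma sum_dedges (F : G -> G -> R) :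
  \sum_(e \in dedges G) F e.1 e.2 =
  \sum_(u \in [set: G]) \sum_(v \in nbr u) F u v.
Proof.
have [fG _] := G_fin.
(* Extending the inner sums by zero makes their range independent of [u]; the double sum then
   becomes a single sum over all pairs. *)
under [RHS]eq_fsbigr do rewrite fsbig_mkcond.
rewrite pair_fsbig// setXTT [LHS]fsbig_mkcond; apply: eq_fsbigr => -[u v] _.
by rewrite /patch/= !mem_setE.
Qed.

Lemma ncard_dedges :
  (ncard (dedges G))%:R = \sum_(v \in [set: G]) ((deg v)%:R : R).
Proof.
rewrite ncardE (sum_dedges (fun _ _ => 1 : R)).
by apply: eq_fsbigr => v _; rewrite /deg ncardE.
Qed.

Lemma vavg_deg :
  vavg (fun v : G => (deg v)%:R : R) =
  (ncard (dedges G))%:R / (ncard [set: G])%:R.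
Proof. by rewrite ncard_dedges. Qed.

(** Both parts of this quotient are vertex averages, whose limits can be taken separately: the
    numerator is local and bounded, the denominator needs uniform integrability. *)
Lemma FstarE l : Fstar R G l =
  vavg (fun v : G => (deg v)%:R * (deg v <= l)%N%:R) /
  vavg (fun v : G => (deg v)%:R).
Proof.
rewrite vavg_deg /Fstar /vavg invf_div mulrA mulfVK//.
by rewrite gt_eqF.
Qed.

Lemma vavg_deg_split K :
  vavg (fun v : G => (deg v)%:R : R) =
  vavg (fun v : G => (deg v)%:R * (deg v <= K)%N%:R) + deg_tail R G K.
Proof.
rewrite /deg_tail -vavgD//; congr vavg; apply/funext => v.
by rewrite leqNgt; case: ltnP => _; rewrite mulr1 mulr0 ?add0r ?addr0.
Qed.

Lemma Fstar_mono l m : (l <= m)%N -> Fstar R G l <= Fstar R G m.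
Proof.
move=> lm; rewrite ler_wpM2r ?invr_ge0 ?ler0n//.
have [fG _] := G_fin; rewrite !fsbig_finite// ler_sum// => v _.
rewrite ler_wpM2l ?ler_nat ?ler0n//.
by case: (leqP (deg v) l) => //= dl; rewrite (leq_trans dl lm).
Qed.

Lemma Fstar_le1 l : Fstar R G l <= 1.
Proof.
have [M0|M0] := eqVneq (ncard (dedges G))%:R (0 : R).
  by rewrite /Fstar M0 invr0 mulr0.
rewrite ler_pdivrMr; last by rewrite lt0r M0 ler0n.
have [fG _] := G_fin; rewrite mul1r ncard_dedges !fsbig_finite// ler_sum// => v _.
by rewrite ler_piMr ?ler0n// lern1 leq_b1.
Qed.

Lemma deg_gt0 (u v : G) : adj u v -> (0 < deg v)%N.
Proof.
move=> uv; rewrite /deg /ncard cardfs_gt0; apply/fset0Pn; exists u.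
by rewrite in_fset_set ?inE ?/nbr/= 1?adj_sym//; exact: finite_subgraph.
Qed.

Lemma fstarE k : fstar R G k = k%:R * fdeg R G k / vavg (fun v : G => (deg v)%:R).
Proof.
rewrite vavg_deg invf_div /fstar /eavg (sum_dedges (fun u _ => (deg u == k)%:R)).
rewrite mulrA /fdeg /vavg -!mulrA (mulrA _^-1) mulVf ?gt_eqF// mul1r.
rewrite !mulrA mulr_fsumr; congr (_ / _); apply: eq_fsbigr => v _.
(* The summand is constant over the neighbours of [v], which yields the factor [deg v]; this equals
   [k] wherever the indicator is nonzero. *)
under eq_fsbigr do rewrite -[_%:R]mulr1.
rewrite -mulr_fsumr -ncardE.
by rewrite -/(deg v); case: eqP => [->|_]; rewrite ?mul1r ?mulr1 ?mul0r ?mulr0.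
Qed.

Lemma sum_hdeg (F : nat -> R) k :
  \sum_(l \in [set l | (0 < l)%N]) F l * hdeg R G k l =
  vavg (fun v : G => (deg v == k)%:R * \sum_(u \in nbr v) F (deg u)) /
  vavg (fun v : G => (deg v)%:R).
Proof.
have [fG _] := G_fin.
(* [L] exceeds all degrees, so [hdeg R G k l] vanishes for [l >= L]. The sum over [l] becomes finite
   and can be exchanged with the sum over edges. *)
pose L := (\max_(v <- fset_set [set: G]) deg v).+1.
have degL (v : G) : (deg v < L)%N.
  by rewrite ltnS; apply: leq_bigmax_seq; rewrite ?in_fset_set ?inE.
have fL : finite_set ([set l | (0 < l)%N] `&` `I_L).
  by apply: sub_finite_set (finite_II L) => l [].
rewrite -(fsbig_widen ([set l | (0 < l)%N] `&` `I_L)); first last.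
- move=> l [l0 /not_andP[//|/negP]]; rewrite -leqNgt => Ll /=.
  rewrite /hdeg /eavg fsbig1 ?mul0r ?mulr0// => -[u v] _ /=.
  by rewrite (ltn_eqF (leq_trans (degL v) Ll)) andbF.
- by move=> l [].
rewrite vavg_deg invf_div mulrA /vavg mulfVK ?gt_eqF//.
transitivity ((\sum_(l \in [set l | (0 < l)%N] `&` `I_L)
   \sum_(e \in dedges G) (F l * ((deg e.1 == k) && (deg e.2 == l))%:R))
      / (ncard (dedges G))%:R).
  by rewrite mulr_fsuml; apply: eq_fsbigr => l _; rewrite -mulr_fsumr mulrA.
have fE : finite_set (dedges G).
  by apply: sub_finite_set (finite_setX fG fG) => -[].
rewrite exchange_fsbig//; congr (_ / _).
rewrite (eq_fsbigr (fun e => (deg e.1 == k)%:R * F (deg e.2))).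
  rewrite (sum_dedges (fun u v => (deg u == k)%:R * F (deg v))).
  by apply: eq_fsbigr => v _; rewrite mulr_fsumr.
move=> -[u v] /set_mem/= uv.
(* For a fixed edge only [l = deg v] contributes, and this value is in the range because [v] has the
   neighbour [u]. *)
rewrite (fsbigD1 (deg v))//=; last by split=> //=; exact: deg_gt0 uv.
rewrite eqxx andbT fsbig1 ?addr0 1?mulrC// => l [_ /eqP].
by rewrite eq_sym => /negbTE->; rewrite andbF mulr0.
Qed.

(** The numerator and [fstar] both carry the mean degree as a denominator, and it cancels. *)
Lemma annrE k : 0 < vavg (fun v : G => (deg v)%:R : R) -> 0 < fdeg R G k ->
  annr R G k =
  vavg (fun v : G => (deg v == k)%:R * \sum_(u \in nbr v) Fstar R G (deg u)) /
  (k%:R * fdeg R G k).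
Proof.
move=> m0 f0; rewrite /annr f0 mul1r sum_hdeg fstarE.
move: m0; move: (vavg (fun v => (deg v)%:R)) => m m0.
by rewrite (invf_div _ m) mulrA mulfVK ?gt_eqF.
Qed.

End finite_graphs.

(** * Countability of finite rooted graphs and measurability *)

(** A walk of at most [r.+1] steps from [v] is trivial or continues from a neighbour of [v] with at
    most [r] steps, so the larger ball is covered by finitely many smaller ones. *)
Lemma finite_ball_set (G : sgraph) r (v : G) :
  locally_finite G -> finite_set (ball_set r v).
Proof.
move=> fG; elim: r v => [|r IHr] v.
  apply: sub_finite_set (finite_set1 v) => u [p [_ <-]].
  by rewrite leqn0 size_eq0 => /eqP ->.
apply: (@sub_finite_set _ _ ([set v] `|` \bigcup_(u in nbr v) ball_set r u)).
  move=> u [[|w p] [/= vp <- pr]]; first by left.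
  by right; move: vp => /andP[vw wp]; exists w => //; exists p.
rewrite finite_setU; split; first exact: finite_set1.
by apply: bigcup_finite => //.
Qed.

Lemma finite_gball (G : sgraph) r (v : G) :
  finite_set (ball_set r v) -> finite_set [set: gball r v].
Proof.
move=> fB; rewrite (_ : setT = (val : gball r v -> G) @^-1` ball_set r v).
  by apply: finite_preimage => // x y _ _; exact: val_inj.
by apply/seteqP; split => // x _ /=; exact/set_mem/(valP x).
Qed.

(** * Enumeration of the finite rooted graphs up to isomorphism *)

Section codes.

(** Symmetrising the table and clearing its diagonal makes every boolean table a valid code, so
    codes carry no proofs and form a countable type. *)
Definition code_adj n (e : {ffun 'I_n.+1 * 'I_n.+1 -> bool}) : rel 'I_n.+1 :=
  fun i j => (i != j) && (e (i, j) || e (j, i)).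

Fact code_adj_sym n e : symmetric (@code_adj n e).
Proof. by move=> i j; rewrite /code_adj eq_sym orbC. Qed.

Fact code_adj_irr n e : irreflexive (@code_adj n e).
Proof. by move=> i; rewrite /code_adj eqxx. Qed.

Definition code_type := {n & {ffun 'I_n.+1 * 'I_n.+1 -> bool} * 'I_n.+1}%type.

Definition code_graph (c : code_type) : rooted_graph :=
  @RootedGraph (SGraph (@code_adj_sym _ (tagged c).1) (@code_adj_irr _ (tagged c).1))
    (tagged c).2.

Lemma code_graph_surj (H : rooted_graph) : finite_set [set: H] ->
  exists c, rooted_iso H (code_graph c).
Proof.
move=> fH; pose s : seq H := fset_set [set: H].
have Hs x : x \in s by rewrite in_fset_set// inE.
have us : uniq s by exact: fset_uniq.
case sn: (size s) => [|n].
  by move: (Hs (groot H)); rewrite (size0nil sn).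
have idx x : (index x s < n.+1)%N by rewrite -sn index_mem.
pose f x : 'I_n.+1 := Ordinal (idx x).
pose g (i : 'I_n.+1) := nth (groot H) s i.
have fK : cancel f g by move=> x; rewrite /g/= nth_index.
have gK : cancel g f by move=> i; apply/val_inj; rewrite /= index_uniq ?sn.
exists (existT _ n ([ffun p => adj (g p.1) (g p.2)], f (groot H))).
exists f; split => //; first by exists g.
move=> x y /=; rewrite /code_adj !ffunE/= !fK (adj_sym y x) orbb.
by rewrite (can_eq fK); case: eqP => [->|//]; rewrite adj_irr.
Qed.

(** Indices that decode to nothing yield the one-vertex graph; isomorphism classes may be
    repeated. *)
Definition nth_graph (i : nat) : rooted_graph :=
  code_graph (odflt (existT _ 0%N ([ffun=> false], ord0)) (choice.unpickle i)).

Lemma nth_graph_surj (H : rooted_graph) : finite_set [set: H] ->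
  exists i, rooted_iso H (nth_graph i).
Proof.
move=> /code_graph_surj[c Hc]; exists (choice.pickle c).
by rewrite /nth_graph choice.pickleK.
Qed.

Lemma nth_graph_finite i : finite_graph (nth_graph i).
Proof.
split; last by exists (groot (nth_graph i)).
by rewrite /nth_graph/code_graph/=; exact: finite_finset.
Qed.

End codes.

Lemma graph_iso_finite (H H' : sgraph) :
  graph_iso H H' -> finite_graph H' -> finite_graph H.
Proof.
move=> [f [g fK gK] _] [fH' [v _]]; split; last by exists (g v).
rewrite (_ : setT = f @^-1` setT)//; apply: finite_preimage => // x y _ _.
exact: can_inj fK _ _.
Qed.

Lemma finite_graph_nth (H : sgraph) :
  finite_graph H -> exists i, graph_iso H (nth_graph i).
Proof.
move=> [fH [v _]].
have [i [f [fb fm _]]] := nth_graph_surj (H := RootedGraph v) fH.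
by exists i, f.
Qed.

Section measurability.
Variables (d : measure_display) (T : measurableType d).

(** Finite rooted graphs have countably many isomorphism classes, so an invariant event is a
    countable union of the events assumed measurable. *)
Lemma measurable_rooted (B : T -> rooted_graph) (Q : rooted_graph -> Prop) :
  (forall H, measurable [set w | rooted_iso (B w) H]) ->
  (forall w, finite_set [set: B w]) ->
  (forall H H', rooted_iso H H' -> Q H -> Q H') ->
  measurable [set w | Q (B w)].
Proof.
move=> mB fB Qiso.
rewrite (_ : [set _ | _] =
  \bigcup_(i in [set i | Q (nth_graph i)]) [set w | rooted_iso (B w) (nth_graph i)]).
  by apply: bigcup_measurable => i _; exact: mB.
apply/seteqP; split => [w /= QB|w [i Qi /= /rooted_iso_sym /Qiso]]; last exact.
have [i Bi] := nth_graph_surj (fB w).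
by exists i => //=; exact: Qiso QB.
Qed.

Variable G : T -> sgraph.
Hypothesis G_random : random_graph G.

(* [b] is the junk value of [Q] on the empty and the infinite graphs, where
   [vavg] divides by 0. *)
Lemma measurable_graph (Q : sgraph -> Prop) (b : Prop) :
  (forall H H', graph_iso H H' -> Q H = Q H') ->
  (forall H, ~ finite_graph H -> Q H = b) ->
  measurable [set w | Q (G w)].
Proof.
move=> Qiso Qb.
have mG i : measurable [set w | graph_iso (G w) (nth_graph i)].
  by apply: G_random; have [] := nth_graph_finite i.
have mfin : measurable [set w | finite_graph (G w)].
  rewrite (_ : [set _ | _] = \bigcup_i [set w | graph_iso (G w) (nth_graph i)]).
    exact: bigcup_measurable.
  apply/seteqP; split => [w /= /finite_graph_nth[i ?]|w [i _ /=]]; first by exists i.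
  by move=> /graph_iso_finite; apply; exact: nth_graph_finite.
rewrite (_ : [set _ | _] =
  \bigcup_(i in [set i | Q (nth_graph i)]) [set w | graph_iso (G w) (nth_graph i)]
  `|` ((~` [set w | finite_graph (G w)]) `&` [set w | b])).
  apply: measurableU; first exact: bigcup_measurable.
  apply: measurableI; first exact: measurableC.
  by have [hb|hb] := pselect b; [rewrite (_ : [set _ | _] = setT)|
    rewrite (_ : [set _ | _] = set0)] => //; apply/seteqP; split.
apply/seteqP; split => [w /= QG|w [[i /= Qi /Qiso ->//]|[/= /Qb ->]]//].
have [/finite_graph_nth[i Gi]|nfin] := pselect (finite_graph (G w)).
  by left; exists i => //=; rewrite -(Qiso _ _ Gi).
by right; split => //=; rewrite -(Qb _ nfin).
Qed.

End measurability.

(** * Limits of averages of local functions *)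

Section expectations.
Variables (R : realType) (d : measure_display) (T : measurableType d).
Variable mu : probability T R.
Implicit Types f g : T -> R.

(** Monotone convergence, where the pointwise limit is reached after finitely many steps. This fits
    truncations and enumerations alike. *)
Lemma cvg_expectation (f_ : nat -> T -> R) f :
  (forall n, measurable_fun setT (f_ n)) -> (forall n w, 0 <= f_ n w) ->
  (forall w, {homo f_^~ w : m n / (m <= n)%N >-> m <= n}) ->
  (forall w, \forall n \near \oo, f_ n w = f w) ->
  ('E_mu[f_ n] @[n --> \oo] --> 'E_mu[f])%E.
Proof.
move=> mf f0 fmono ff; rewrite unlock.
rewrite (_ : (fun w => (f w)%:E) = (fun w => limn (fun n => (f_ n w)%:E))).
  apply: cvg_monotone_convergence => //.
  - by move=> n; exact/measurable_EFinP.
  - by move=> n w _; rewrite lee_fin.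
  - by move=> w _ m n mn; rewrite lee_fin fmono.
apply/funext => w; apply/esym/cvg_lim => //.
apply: cvg_near_cst; near=> n; congr EFin; near: n; exact: ff.
Unshelve. all: by end_near. Qed.

Lemma expectation_mono f g : measurable_fun setT f -> measurable_fun setT g ->
  (forall w, 0 <= f w) -> (forall w, f w <= g w) -> ('E_mu[f] <= 'E_mu[g])%E.
Proof.
move=> mf mg f0 fg; rewrite unlock; apply: ge0_le_integral => //.
- by move=> w _; rewrite lee_fin.
- exact/measurable_EFinP.
- exact/measurable_EFinP.
- by move=> w _; rewrite lee_fin.
Qed.

Lemma expectation_fin f (C : R) : measurable_fun setT f ->
  (forall w, 0 <= f w <= C) -> 'E_mu[f]%E \is a fin_num.
Proof.
move=> mf fC; rewrite ge0_fin_numE; last first.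
  by apply: expectation_ge0 => w; have /andP[] := fC w.
apply: (@le_lt_trans _ _ 'E_mu[cst C]%E); last by rewrite expectation_cst ltry.
by apply: expectation_mono => // w; have /andP[] := fC w.
Qed.

(** Both [C - f] and [f] are nonnegative, so additivity of the integral applies to their sum, which
    is the constant [C]. *)
Lemma expectation_compl f (C : R) : measurable_fun setT f ->
  (forall w, 0 <= f w <= C) ->
  fine 'E_mu[fun w => (C - f w)%R]%E = C - fine 'E_mu[f]%E.
Proof.
move=> mf fC; have mCf : measurable_fun setT (fun w => C - f w).
  exact: measurable_funB.
have E1 : ('E_mu[fun w => (C - f w)%R] + 'E_mu[f] = C%:E)%E.
  rewrite -(expectation_cst mu C) unlock -ge0_integralD//.
  - by apply: eq_integral => w _; rewrite -EFinD subrK.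
  - by move=> w _; rewrite lee_fin subr_ge0; have /andP[] := fC w.
  - exact/measurable_EFinP.
  - by move=> w _; rewrite lee_fin; have /andP[] := fC w.
  - exact/measurable_EFinP.
have fin1 := expectation_fin mf fC.
have fin2 : 'E_mu[fun w => (C - f w)%R]%E \is a fin_num.
  apply: (@expectation_fin _ C) => // w; rewrite subr_ge0 lerBlDr lerDl.
  by have /andP[f0 f1] := fC w; rewrite f1 f0.
apply/eqP; rewrite eq_sym subr_eq; apply/eqP.
by have := congr1 fine E1; rewrite fineD.
Qed.

Lemma expectationZ_bounded (c C : R) (f : T -> R) : 0 <= c ->
  measurable_fun setT f -> (forall w, 0 <= f w <= C) ->
  fine 'E_mu[fun w => (c * f w)%R]%E = c * fine 'E_mu[f]%E.
Proof.
move=> c0 mf fC; have := expectation_fin mf fC; rewrite unlock => Ef.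
rewrite -[c in RHS]/(fine c%:E) -fineM// -ge0_integralZl_EFin//.
- by move=> w _; rewrite lee_fin; have /andP[] := fC w.
- exact/measurable_EFinP.
Qed.

Lemma expectation_simple n (c : 'I_n -> R) (A : 'I_n -> set T) :
  (forall i, 0 <= c i) -> (forall i, measurable (A i)) ->
  fine 'E_mu[fun w => (\sum_(i < n) c i * (`[< A i w >])%:R)%R]%E =
  \sum_(i < n) c i * fine (mu (A i)).
Proof.
move=> c0 mA; rewrite unlock.
have EA i w : (`[< A i w >])%:R = \1_(A i) w :> R by rewrite indicE.
transitivity (fine (\int[mu]_w \sum_(i < n) ((c i)%:E * (\1_(A i) w)%:E))%E).
  congr fine; apply: eq_integral => w _.
  by rewrite -sumEFin; apply: eq_bigr => i _; rewrite EA EFinM.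
have mA1 i : measurable_fun setT (EFin \o (\1_(A i) : T -> R)).
  exact/measurable_EFinP/measurable_indic.
rewrite ge0_integral_sum//; first last.
- by move=> i w _; rewrite mule_ge0// lee_fin.
- by move=> i; apply: measurable_funeM; exact: mA1.
transitivity (fine (\sum_(i < n) (c i * fine (mu (A i)))%:E)%E); last first.
  by rewrite sumEFin.
congr fine; apply: eq_bigr => i _.
rewrite ge0_integralZl_EFin//; last exact: mA1.
rewrite integral_indic// setIT EFinM fineK//.
exact: fin_num_measure.
Qed.

End expectations.

(** * Convergence of averages of bounded local functions along a filter *)

Section local_limit.
Variables (R : realType) (W : Type) (FF : set_system W).
Context {FF_filter : Filter FF}.
Variable Gr : W -> sgraph.
Hypothesis Gr_fin : \forall x \near FF, finite_graph (Gr x).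
Variables (d : measure_display) (T : measurableType d) (mu : probability T R).
Variable G : T -> rooted_graph.
Hypothesis G_random : random_rooted_graph G.
Hypothesis G_locfin : forall w, locally_finite (G w).
Variable r : nat.

Local Notation B w := (gball r (groot (G w))).

Hypothesis Gr_cvg : forall H,
  vavg (fun v : Gr x => (`[< rooted_iso (gball r v) H >])%:R) @[x --> FF] -->
  (fine (mu [set w | rooted_iso (B w) H]) : R).

Definition iso_invariant (phi : rooted_graph -> R) :=
  forall H H', rooted_iso H H' -> phi H = phi H'.

Lemma measurable_iso_invariant phi :
  iso_invariant phi -> measurable_fun setT (fun w => phi (B w)).
Proof.
move=> phi_iso _ Y _; rewrite setTI.
apply: (measurable_rooted (Q := fun H => Y (phi H))) => [H|w|H H' HH'].
- exact: G_random.
- by apply: finite_gball; exact: finite_ball_set.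
- by rewrite (phi_iso _ _ HH').
Qed.

(** Selects the first representative of each isomorphism class, so that repetitions in the
    enumeration are counted once. *)
Definition first_code (i : nat) : bool :=
  `[< forall j, (j < i)%N -> ~ rooted_iso (nth_graph j) (nth_graph i) >].

(** As a finite combination of indicators of isomorphism classes, its vertex average converges
    directly by [Gr_cvg]. *)
Definition finite_approx (phi : rooted_graph -> R) n (H : rooted_graph) : R :=
  \sum_(i < n) ((first_code i)%:R * phi (nth_graph i)) *
               (`[< rooted_iso H (nth_graph i) >])%:R.

Lemma finite_approxE phi n H : iso_invariant phi -> finite_approx phi n H =
  (`[< exists2 i, (i < n)%N & rooted_iso H (nth_graph i) >])%:R * phi H.
Proof.
move=> phi_iso; rewrite /finite_approx; elim: n => [|n IHn].
  by rewrite big_ord0; case: asboolP => [[]//|_]; rewrite mul0r.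
rewrite big_ord_recr/= IHn; case: (asboolP (rooted_iso H (nth_graph n))) => Hn.
  rewrite -(phi_iso _ _ Hn) mulr1 -mulrDl; congr (_ * _).
  rewrite (_ : `[< exists2 _, (_ < n.+1)%N & _ >] = true); last first.
    by apply/asboolP; exists n.
  (* [H] has the class of code [n]. Either this class occurred before, and the new term vanishes, or
     it is new, and the earlier terms vanish. *)
  rewrite /first_code; case: asboolP => [[i ni Hi]|Hi]; case: asboolP => Hj.
  - by case: (Hj _ ni); apply: rooted_iso_trans Hn; exact: rooted_iso_sym.
  - by rewrite addr0.
  - by rewrite add0r.
  - case: Hj => j jn jiso; apply: Hi; exists j => //.
    by apply: rooted_iso_trans Hn _; exact: rooted_iso_sym.
rewrite mulr0 addr0; congr ((nat_of_bool _)%:R * _).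
apply/asbool_equiv_eq; split=> -[i ni Hi].
  by exists i => //; exact: leqW.
exists i => //; rewrite ltn_neqAle -ltnS ni andbT.
by apply/eqP => ein; apply: Hn; rewrite -ein.
Qed.

(** The approximations increase to [phi], so one of them has expectation above that of [phi] minus
    [e]. Its vertex average converges, and it is dominated by that of [phi]. *)
Lemma vavg_lower_limit phi (C e : R) : iso_invariant phi ->
  (forall H, 0 <= phi H <= C) -> 0 < e ->
  \forall x \near FF, fine 'E_mu[fun w => phi (B w)]%E - e <=
                      vavg (fun v : Gr x => phi (gball r v)).
Proof.
move=> phi_iso phiC e0.
have phi0 H : 0 <= phi H by have /andP[] := phiC H.
have Aiso n : iso_invariant (finite_approx phi n).
  move=> H H' HH'; apply: eq_bigr => i _; congr (_ * (nat_of_bool _)%:R).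
  apply/asbool_equiv_eq; split; apply: rooted_iso_trans => //.
  exact: rooted_iso_sym.
have Ele H n : finite_approx phi n H <= phi H.
  by rewrite finite_approxE//; case: asboolP => _; rewrite ?mul1r ?mul0r.
have E0 H n : 0 <= finite_approx phi n H.
  by rewrite finite_approxE// mulr_ge0.
have E1 : ('E_mu[fun w => finite_approx phi n (B w)] @[n --> \oo] -->
           'E_mu[fun w => phi (B w)])%E.
  apply: cvg_expectation => //.
  - by move=> n; exact: measurable_iso_invariant.
  - move=> w m n mn; rewrite !finite_approxE// ler_wpM2r// ler_nat.
    case: asboolP => // -[i im Bi]; rewrite asboolT//.
    by exists i => //; exact: leq_trans mn.
  - move=> w; have [|i Bi] := @nth_graph_surj (B w).
      by apply: finite_gball; exact: finite_ball_set.
    exists i.+1 => // n /= ni; rewrite finite_approxE// asboolT ?mul1r//.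
    by exists i.
have phifin : 'E_mu[fun w => phi (B w)]%E \is a fin_num.
  exact: expectation_fin (measurable_iso_invariant phi_iso) _.
rewrite -(fineK phifin) in E1.
have /fine_cvg/cvgr_gt/(_ (fine 'E_mu[fun w => phi (B w)]%E - e)) := E1.
rewrite ltrBlDr ltrDl => /(_ e0)[n _ /(_ n (leqnn n))/= nE].
have : vavg (fun v : Gr x => finite_approx phi n (gball r v)) @[x --> FF] -->
       fine 'E_mu[fun w => finite_approx phi n (B w)]%E.
  rewrite expectation_simple; first last.
  - by move=> i; exact: G_random.
  - by move=> i; rewrite mulr_ge0.
  apply: (cvg_trans _ (_ : (\sum_(i < n) ((first_code i)%:R * phi (nth_graph i)) *
      vavg (fun v : Gr x => (`[< rooted_iso (gball r v) (nth_graph i) >])%:R))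
      @[x --> FF] --> _)).
    apply: near_eq_cvg; near=> x.
    rewrite /finite_approx vavg_sum; last by near: x.
    by apply: eq_bigr => i _; rewrite vavgZ.
  apply: cvg_big => [|i _]; first exact: add_continuous.
  by apply: cvgMr.
move=> /cvgr_gt/(_ _ nE); apply: filterS2 Gr_fin => x fx xE.
by rewrite (le_trans (ltW xE))// ler_vavg.
Unshelve. all: by end_near. Qed.

(** No mass escapes to large balls, because vertex averages and [mu] both have total mass 1: the
    lower bound for [C - phi] is therefore an upper bound for [phi]. *)
Lemma cvg_vavg_local phi (C : R) : iso_invariant phi ->
  (forall H, 0 <= phi H <= C) ->
  vavg (fun v : Gr x => phi (gball r v)) @[x --> FF] -->
  fine 'E_mu[fun w => phi (B w)]%E.
Proof.
move=> phi_iso phiC; apply/cvgrPdist_le => e e0.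
have := vavg_lower_limit phi_iso phiC e0.
have phiC' H : 0 <= C - phi H <= C.
  by have /andP[h0 h1] := phiC H; rewrite subr_ge0 h1 lerBlDr lerDl.
have phi'_iso : iso_invariant (fun H => C - phi H).
  by move=> H H' /phi_iso ->.
have := vavg_lower_limit phi'_iso phiC' e0.
rewrite (expectation_compl mu (measurable_iso_invariant phi_iso) (fun w => phiC (B w))).
apply: filterS3 Gr_fin => x fx.
move=> U L; have VC : vavg (fun v : Gr x => C - phi (gball r v)) =
       C - vavg (fun v : Gr x => phi (gball r v)).
  rewrite -[in RHS](vavg_cst fx C) -mulN1r -vavgZ -vavgD//.
  by congr vavg; apply/funext => v; rewrite mulN1r.
move: U; rewrite VC lerBlDr -subr_ge0 => U; move: L; rewrite -subr_ge0 => L.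
by rewrite ler_norml -subr_ge0 -[X in _ && X]subr_ge0; apply/andP; split; lra.
Qed.

End local_limit.

(** * Convergence with high probability and the mean degree *)

Section random_graphs.
Variables (R : realType) (d : measure_display) (T : measurableType d).
Variable G : T -> sgraph.
Hypothesis G_random : random_graph G.

Lemma measurable_deg_tail K : measurable_fun setT (fun w => deg_tail R (G w) K).
Proof.
move=> _ Y _; rewrite setTI.
apply: (measurable_graph G_random (Q := fun H => Y (deg_tail R H K)) (b := Y 0)).
  by move=> H H' [f fb fm]; rewrite (deg_tail_iso fb fm).
by move=> H nH; rewrite /deg_tail vavg_not_finite_graph.
Qed.

Lemma measurable_annr k : measurable_fun setT (fun w => annr R (G w) k).
Proof.
move=> _ Y _; rewrite setTI.
apply: (measurable_graph G_random (Q := fun H => Y (annr R H k)) (b := Y 0)).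
  by move=> H H' [f fb fm]; rewrite (annr_iso fb fm).
by move=> H nH; rewrite /annr /fdeg vavg_not_finite_graph// ltxx mul0r.
Qed.

Lemma measurable_ball_freq r (H : rooted_graph) : measurable_fun setT
  (fun w => vavg (fun v : G w => (`[< rooted_iso (gball r v) H >])%:R) : R).
Proof.
move=> _ Y _; rewrite setTI.
apply: (measurable_graph G_random (b := Y 0) (Q := fun G => Y
  (vavg (fun v : G => (`[< rooted_iso (gball r v) H >])%:R)))); last first.
  by move=> G' nG'; rewrite vavg_not_finite_graph.
move=> G1 G2 [f fb fm]; congr Y; apply/esym/(vavg_iso fb) => v.
congr (nat_of_bool _)%:R; apply/asbool_equiv_eq; have vf := gball_iso r v fb fm.
split; apply: rooted_iso_trans => //; exact: rooted_iso_sym.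
Qed.

Lemma measurable_superlevel (X : T -> R) (e : R) : measurable_fun setT X ->
  measurable [set w | e < X w].
Proof.
move=> mX; rewrite (_ : [set _ | _] = X @^-1` `]e, +oo[).
  by rewrite -[X in measurable X]setTI; exact: mX.
by apply/seteqP; split => w; rewrite /= in_itv/= andbT.
Qed.

Lemma measurable_deviation (X : T -> R) (c e : R) : measurable_fun setT X ->
  measurable [set w | e < `|X w - c|].
Proof.
move=> mX; apply: measurable_superlevel.
by apply: measurableT_comp => //; exact: measurable_funB.
Qed.

End random_graphs.

Lemma markov_inequality (R : realType) d (T : measurableType d)
    (P : probability T R) (X : T -> R) (e : R) :
  measurable_fun setT X -> (forall w, 0 <= X w) -> 0 < e ->
  (e%:E * P [set w | (e < X w)%R] <= 'E_P[X])%E.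
Proof.
move=> mX X0 e0; set A := [set _ | _].
have mA : measurable A by exact: measurable_superlevel.
have mA1 : measurable_fun setT (\1_A : T -> R) by exact: measurable_indic.
rewrite -(setIT A) -(integral_indic P measurableT mA).
rewrite -ge0_integralZl_EFin ?(ltW e0)//; last exact/measurable_EFinP.
rewrite unlock; apply: ge0_le_integral => //.
- by move=> w _; rewrite mule_ge0// lee_fin ltW.
- by apply: measurable_funeM; exact/measurable_EFinP.
- exact/measurable_EFinP.
- move=> w _; rewrite -EFinM lee_fin indicE.
  by case: (boolP (w \in A)) => [/set_mem/ltW|_]; rewrite ?mulr1 ?mulr0.
Qed.

(** * The filter of events of high probability *)

Section high_probability.
Variables (R : realType) (dn : nat -> measure_display).
Variables (Omega : forall n, measurableType (dn n)).
Variable P : forall n, probability (Omega n) R.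

(* The filter turning convergence in probability into plain convergence, so
   that limits of sums, products and quotients are available. *)
Definition whp : set_system {n & Omega n} :=
  [set A | forall e : R, 0 < e -> \forall n \near \oo,
    exists B : set (Omega n), [/\ measurable B, (P n B <= e%:E)%E &
      forall w, ~ B w -> A (existT _ n w)]].

Global Instance whp_filter : Filter whp.
Proof.
split=> [e e0|A B wA wB e e0|A B AB wA e e0].
- by near=> n; exists set0; split => //; rewrite measure0 lee_fin ltW.
- have e20 : 0 < e / 2 by rewrite divr_gt0.
  near=> n.
  have [A' [mA PA A'A]] : exists C : set (Omega n),
      [/\ measurable C, (P n C <= (e / 2)%:E)%E &
       forall w, ~ C w -> A (existT _ n w)] by near: n; exact: wA.
  have [B' [mB PB B'B]] : exists C : set (Omega n),
      [/\ measurable C, (P n C <= (e / 2)%:E)%E &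
       forall w, ~ C w -> B (existT _ n w)] by near: n; exact: wB.
  exists (A' `|` B'); split.
  + exact: measurableU.
  + apply: (le_trans (measureU2 _ mA mB)).
    by rewrite (splitr e) EFinD leeD.
  + by move=> w /not_orP[nA nB]; split; [exact: A'A|exact: B'B].
- apply: filterS (wA e e0) => n [C [mC PC CA]]; exists C; split => // w nC.
  exact/AB/CA.
Unshelve. all: by end_near. Qed.

(** The deviation event serves as exceptional set in one direction; in the other it is contained in
    the given exceptional set. *)
Lemma cvg_in_probP (X : forall n, Omega n -> R) (c : R) :
  (forall n, measurable_fun setT (X n)) ->
  cvg_in_prob P X c <-> X (projT1 x) (projT2 x) @[x --> whp] --> c.
Proof.
move=> mX; split=> [cX|cX].
  apply/cvgrPdist_le => e e0 h h0.
  have /fine_cvgP[_ /cvgrPdist_le/(_ h h0)] := cX e e0.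
  apply: filterS => n /=; rewrite sub0r normrN ger0_norm ?fine_ge0// => Ph.
  exists [set w | e < `|X n w - c|]; split.
  - exact: measurable_deviation.
  - rewrite -[leLHS]fineK ?lee_fin//.
    exact/fin_num_measure/measurable_deviation.
  - by move=> w /negP; rewrite -leNgt distrC.
move=> e e0; have mA n : measurable [set w | e < `|X n w - c|].
  exact: measurable_deviation.
apply/fine_cvgP; split; first by near=> n; exact: fin_num_measure.
apply/cvgrPdist_le => h h0; have /cvgrPdist_le/(_ e e0 h h0) := cX.
apply: filterS => n [B [mB PB BX]] /=.
rewrite sub0r normrN ger0_norm ?fine_ge0// -lee_fin fineK; last exact: fin_num_measure.
apply: le_trans PB; apply: le_measure; rewrite ?inE//.
move=> w /= eX; apply: contrapT => /BX /=; rewrite distrC leNgt eX//.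
Unshelve. all: by end_near. Qed.

(** Extracts one actual outcome from a statement of high probability: the exceptional sets have
    total mass at most 1/2 + 1/4, which is less than 1. *)
Lemma whp_meets (A : set {n & Omega n}) (B : forall n, set (Omega n)) :
  whp A -> (forall n, measurable (B n)) -> (forall n, P n (B n) <= (1 / 2)%:E)%E ->
  exists n w, A (existT _ n w) /\ ~ B n w.
Proof.
move=> wA mB PB; have [|n _ /(_ n (leqnn n))[C [mC PC CA]]] := wA (1 / 4).
  by rewrite divr_gt0.
apply: contrapT => nex.
have : (P n setT <= (1 / 2 + 1 / 4)%:E)%E.
  apply: (@le_trans _ _ (P n (B n `|` C))).
    apply: le_measure; rewrite ?inE//; first exact: measurableU.
    move=> w _; apply: contrapT => /not_orP[nB nC]; apply: nex; exists n, w.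
    by split => //; exact: CA.
  by apply: (le_trans (measureU2 _ (mB n) mC)); rewrite EFinD; exact: (leeD (PB n) PC).
by rewrite probability_setT lee_fin; lra.
Qed.

Variable Gn : forall n, Omega n -> sgraph.
Hypothesis Gn_random : forall n, random_graph (@Gn n).
Hypothesis Gn_ui : deg_unif_integrable P (@Gn).

Local Notation Gr x := (Gn (projT2 x)).

Hypothesis Gn_fin : \forall x \near whp, finite_graph (Gr x).

Lemma deg_tail_small (e h : R) : 0 < e -> 0 < h -> \forall K \near \oo,
  forall n, (P n [set w | (e < deg_tail R (Gn w) K)%R] <= h%:E)%E.
Proof.
(* Markov's inequality divides the expected tail by [e], so a bound [e * h] on the supremum over [n]
   leaves [h]. *)
move=> e0 h0; have /fine_cvgP[sfin /cvgrPdist_le/(_ (e * h))] := Gn_ui.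
rewrite mulr_gt0// => /(_ isT) s0; near=> K => n.
have : (e%:E * P n [set w | (e < deg_tail R (Gn w) K)%R] <= (e * h)%:E)%E.
  apply: le_trans (markov_inequality _ _ _ e0) _.
  - exact: measurable_deg_tail.
  - by move=> w; exact: deg_tail_ge0.
  - have /ereal_sup_ubound/le_trans := imageT
      (fun n => 'E_(P n)[fun w => deg_tail R (Gn w) K])%E n.
    apply; rewrite -[leLHS]fineK; last by near: K.
    rewrite lee_fin; apply: le_trans (ler_norm _) _; rewrite -normrN -sub0r.
    by near: K.
by rewrite EFinM lee_pmul2l.
Unshelve. all: by end_near. Qed.

Variables (d : measure_display) (T : measurableType d) (mu : probability T R).
Variable D : T -> nat.
Hypothesis D_meas : forall F : nat -> R, measurable_fun setT (fun w => F (D w)).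

Local Notation trunc K :=
  'E_mu[fun w => ((D w)%:R * (D w <= K)%N%:R)%R]%E.

Hypothesis trunc_cvg : forall K,
  vavg (fun v : Gr x => (deg v)%:R * (deg v <= K)%N%:R) @[x --> whp] -->
  fine (trunc K).

Lemma trunc_expectation_cvg :
  (trunc K @[K --> \oo] --> 'E_mu[fun w => ((D w)%:R)%R])%E.
Proof.
apply: cvg_expectation.
- by move=> K; apply: (D_meas (fun m => m%:R * (m <= K)%N%:R)).
- by move=> K w; rewrite mulr_ge0 ?ler0n.
- move=> w m n mn; rewrite ler_wpM2l ?ler_nat//.
  by case: (leqP (D w) m) => // dm; rewrite (leq_trans dm mn).
- by move=> w; exists (D w) => // n /= ->; rewrite mulr1.
Qed.

Lemma trunc_fin K : trunc K \is a fin_num.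
Proof.
apply: (@expectation_fin _ _ _ _ _ K%:R).
  by apply: (D_meas (fun m => m%:R * (m <= K)%N%:R)).
move=> w; rewrite mulr_ge0 ?ler0n//=.
by case: leqP => DK; rewrite ?mulr1 ?mulr0 ?ler0n ?ler_nat.
Qed.

(** All truncated means are bounded by one constant. In a suitable outcome the degrees up to [K0]
    contribute at most [K0] to the average, those above at most 2, and the truncated average is
    within 1 of its limit: hence [K0 + 3]. *)
Lemma mean_deg_fin : 'E_mu[fun w => ((D w)%:R)%R]%E \is a fin_num.
Proof.
have [K0 _ /(_ K0 (leqnn K0)) tail0] : \forall K \near \oo, forall n,
  (P n [set w | (2 < deg_tail R (Gn w) K)%R] <= (1 / 2)%:E)%E.
  by apply: deg_tail_small; rewrite ?divr_gt0.
have truncle K : (trunc K <= (K0%:R + 3)%:E)%E.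
  rewrite -(fineK (trunc_fin K)) lee_fin.
  have /cvgrPdist_le/(_ 1 ltr01) trK := trunc_cvg (K := K).
  have [|n [w [[trw fw] /negP]]] := whp_meets (filterI trK Gn_fin) _ tail0.
    by move=> n; exact/measurable_superlevel/measurable_deg_tail.
  rewrite -leNgt => tw; move: trw => /= /ler_normlW trw.
  have L1 : vavg (fun v : Gn w => (deg v)%:R * (deg v <= K)%N%:R) <=
            vavg (fun v : Gn w => (deg v)%:R) :> R.
    apply: ler_vavg => // v; rewrite ler_piMr ?ler0n// lern1 leq_b1//.
  have L2 : vavg (fun v : Gn w => (deg v)%:R * (deg v <= K0)%N%:R) <= K0%:R :> R.
    rewrite -[leRHS](vavg_cst fw); apply: ler_vavg => // v.
    by case: leqP => DK; rewrite ?mulr1 ?mulr0 ?ler0n ?ler_nat.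
  by rewrite (vavg_deg_split R fw K0) in L1; lra.
rewrite ge0_fin_numE; last by apply: expectation_ge0 => w; rewrite ler0n.
apply: (@le_lt_trans _ _ (K0%:R + 3)%:E); last exact: ltry.
by apply: (cvge_to_le trunc_expectation_cvg); near=> K; exact: truncle.
Unshelve. all: by end_near. Qed.

Lemma cvg_mean_deg :
  vavg (fun v : Gr x => (deg v)%:R) @[x --> whp] -->
  fine 'E_mu[fun w => ((D w)%:R)%R]%E.
Proof.
apply/cvgrPdist_le => e e0 h h0.
have e30 : 0 < e / 3 by rewrite divr_gt0.
have h20 : 0 < h / 2 by rewrite divr_gt0.
have := trunc_expectation_cvg; rewrite -(fineK mean_deg_fin).
move=> /fine_cvg/cvgrPdist_le/(_ _ e30) mK.
(* The level [K] is fixed before [n] grows, which is possible because the tail bound is uniform in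
   [n]. The three errors are the truncation of the limit, the convergence at level [K], and the
   tail. *)
have [K _ /(_ K (leqnn K))[/= mKe tailK]] := filterI mK (deg_tail_small e30 h20).
have /cvgrPdist_le/(_ _ e30) trK := trunc_cvg (K := K).
have tf : whp [set x | `|fine (trunc K) - vavg (fun v : Gr x =>
    (deg v)%:R * (deg v <= K)%N%:R)| <= e / 3 /\ finite_graph (Gr x)].
  exact: filterI trK Gn_fin.
apply: filterS (tf _ h20) => n [B [mB PB BX]].
have mA : measurable [set w : Omega n | e / 3 < deg_tail R (Gn w) K].
  exact/measurable_superlevel/measurable_deg_tail.
exists (B `|` [set w | (e / 3 < deg_tail R (Gn w) K)%R]); split.
- exact: measurableU.
- by apply: (le_trans (measureU2 _ mB mA)); rewrite (splitr h) EFinD;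
    exact: leeD PB (tailK n).
- move=> w /not_orP[/BX[/= tr fw] /negP]; rewrite -leNgt => tw.
  rewrite (vavg_deg_split R fw K) opprD addrA.
  set a := fine (trunc K) in tr mKe *.
  have tw0 := deg_tail_ge0 R (Gn w) K.
  move: tr mKe; rewrite !ler_norml => /andP[? ?] /andP[? ?].
  by apply/andP; split; lra.
Qed.

End high_probability.

(** * Convergence of the ANNR *)

Section uniform_cvg.
Variables (R : realType) (W : Type) (FF : set_system W).
Context {FF_filter : Filter FF}.

(* Polya's argument: beyond a level L where F is close to 1, monotonicity
   confines both functions to the same short interval below 1. *)
Lemma uniform_cdf_cvg (F_ : W -> nat -> R) (F : nat -> R) :
  (\forall x \near FF, (forall l m, (l <= m)%N -> F_ x l <= F_ x m) /\
                       (forall l, F_ x l <= 1)) ->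
  (forall l m, (l <= m)%N -> F l <= F m) -> (forall l, F l <= 1) ->
  F l @[l --> \oo] --> (1 : R) ->
  (forall l, F_ x l @[x --> FF] --> F l) ->
  forall e, 0 < e -> \forall x \near FF, forall l, `|F_ x l - F l| <= e.
Proof.
move=> Fx Fm F1 Flim FxF e e0.
have e20 : 0 < e / 2 by rewrite divr_gt0.
have /cvgrPdist_le/(_ _ e20)[L _ /(_ L (leqnn L))/= FL] := Flim.
have : \forall x \near FF, forall l : 'I_L.+1, `|F l - F_ x l| <= e / 2.
  by apply: filter_forall => l; have /cvgrPdist_le/(_ _ e20) := FxF l.
apply: filterS2 Fx => x [Fxm Fx1] xF l; have [lL|Ll] := ltnP l L.+1.
  by rewrite distrC; apply: le_trans (xF (Ordinal lL)) _; lra.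
have /= := xF ord_max; move: FL; rewrite !ler_norml => /andP[? ?] /andP[? ?].
have := Fxm _ _ (ltnW Ll); have := Fm _ _ (ltnW Ll).
by have := Fx1 l; have := F1 l; move=> *; apply/andP; split; lra.
Qed.

End uniform_cvg.

Section rooted_functions.
Variable R : realType.
Implicit Types (H : rooted_graph) (F : nat -> R).

(** On roots of degree [k] this is [k] times the mean of [F (deg u)] over a uniform neighbour [u].
    Stated for rooted graphs, it serves both the finite graphs and the limit. *)
Definition nbr_sum k F H : R :=
  (deg (groot H) == k)%:R * \sum_(u \in nbr (groot H)) F (deg u).

Lemma iso_invariant_deg F : iso_invariant (fun H => F (deg (groot H))).
Proof. by move=> H H' [f [fb fm fr]] /=; rewrite -fr (deg_iso fb fm). Qed.

Lemma iso_invariant_nbr_sum k F : iso_invariant (nbr_sum k F).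
Proof.
move=> H H' [f [fb fm fr]]; rewrite /nbr_sum -fr (deg_iso fb fm).
rewrite (reindex_fsbig _ _ _ _ (nbr_bij fb fm _)); congr (_ * _).
by apply: eq_fsbigr => u _; rewrite (deg_iso fb fm).
Qed.

Lemma nbr_sum_norm_le k (C : R) F H : (0 < k)%N -> (forall l, `|F l| <= C) ->
  `|nbr_sum k F H| <= k%:R * C.
Proof.
move=> k0 FC; have C0 : 0 <= C := le_trans (normr_ge0 _) (FC 0%N).
rewrite /nbr_sum; case: eqP => [dk|_]; last by rewrite mul0r normr0 mulr_ge0.
(* An infinite neighbourhood would have [deg] equal to 0, which [k > 0] excludes. *)
have fin : finite_set (nbr (groot H)).
  apply: contrapT => inf; move: k0; rewrite -dk /deg /ncard /fset_set.
  by case: pselect => // _; rewrite cardfs0.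
rewrite mul1r -dk /deg ncardE mulr_fsuml !fsbig_finite//.
by apply: le_trans (ler_norm_sum _ _ _) _; rewrite ler_sum// => u _; rewrite mul1r.
Qed.

Lemma nbr_sum_bounds k (C : R) F H : (0 < k)%N -> (forall l, 0 <= F l <= C) ->
  0 <= nbr_sum k F H <= k%:R * C.
Proof.
move=> k0 FC; have F0 l : 0 <= F l by have /andP[] := FC l.
have s0 : 0 <= nbr_sum k F H by rewrite mulr_ge0 ?fsumr_ge0.
rewrite s0 -(ger0_norm s0) nbr_sum_norm_le// => l.
by rewrite ger0_norm//; have /andP[] := FC l.
Qed.

Lemma nbr_sumB k F F' (G : sgraph) (v : G) : finite_graph G ->
  nbr_sum k F (RootedGraph v) - nbr_sum k F' (RootedGraph v) =
  nbr_sum k (fun l => F l - F' l) (RootedGraph v).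
Proof.
move=> fG; rewrite /nbr_sum -mulrBr; congr (_ * _) => /=.
have fN := finite_subgraph fG (nbr v).
by rewrite !fsbig_finite// -sumrB.
Qed.

Lemma nbr_sum_gball k F (G : sgraph) (o : G) :
  nbr_sum k F (gball 2 o) = nbr_sum k F (RootedGraph o).
Proof. by rewrite /nbr_sum deg_gball_root sum_nbr_gball. Qed.

End rooted_functions.

(** * The limiting degree distribution and the limiting ANNR *)

Section limit_law.
Variables (R : realType) (d : measure_display) (T : measurableType d).
Variable mu : probability T R.
Variable G : T -> rooted_graph.
Hypothesis G_random : random_rooted_graph G.
Hypothesis G_locfin : forall w, locally_finite (G w).

Lemma measurable_root_deg (F : nat -> R) :
  measurable_fun setT (fun w => F (deg (groot (G w)))).
Proof.
have := measurable_iso_invariant G_random G_locfin 2 (@iso_invariant_deg R F).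
by under eq_fun do rewrite deg_gball_root.
Qed.

Lemma measurable_deg_set (A : set nat) :
  measurable [set w | A (deg (groot (G w)))].
Proof.
have := measurable_root_deg (fun m => (`[< A m >])%:R) measurableT
  (measurable_set1 1).
rewrite setTI; congr (measurable _); apply/seteqP; split => w /=.
  by case: asboolP => // _ /esym/eqP; rewrite oner_eq0.
by move=> ?; rewrite asboolT.
Qed.

Lemma measurable_nbr_sum k (F : nat -> R) :
  measurable_fun setT (fun w => nbr_sum k F (G w)).
Proof.
have := measurable_iso_invariant G_random G_locfin 2 (@iso_invariant_nbr_sum R k F).
by under eq_fun do rewrite nbr_sum_gball.
Qed.

Local Notation D w := (deg (groot (G w))).
Local Notation m := (fine ('E_mu[fun w => ((D w)%:R)%R])%E : R).
Local Notation trunc l :=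
  ('E_mu[fun w => ((D w)%:R * (D w <= l)%N%:R)%R])%E.

Lemma trunc_deg_mono l n : (l <= n)%N -> fine (trunc l) <= fine (trunc n).
Proof.
move=> ln; have mt := fun l => measurable_root_deg (fun m => m%:R * (m <= l)%N%:R).
rewrite fine_le ?(trunc_fin _ measurable_root_deg)//.
apply: expectation_mono => [||w|w]; [exact: mt|exact: mt|by rewrite mulr_ge0|].
rewrite ler_wpM2l// ler_nat; case: (leqP (D w) l) => // Dl.
by rewrite (leq_trans Dl ln).
Qed.

Hypothesis m_fin : 'E_mu[fun w => ((D w)%:R)%R]%E \is a fin_num.
Hypothesis m_gt0 : 0 < m.

Lemma Fstar_mu_mono l n : (l <= n)%N -> Fstar_mu mu G l <= Fstar_mu mu G n.
Proof.
by move=> ln; rewrite ler_wpM2r ?invr_ge0 ?(ltW m_gt0)// trunc_deg_mono.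
Qed.

Lemma Fstar_mu_cvg1 : Fstar_mu mu G l @[l --> \oo] --> (1 : R).
Proof.
have m_neq0 : m != 0 by rewrite gt_eqF.
rewrite -(divff m_neq0); apply: cvgMl.
have := @trunc_expectation_cvg _ _ _ mu _ measurable_root_deg.
by rewrite -(fineK m_fin) => /fine_cvg.
Qed.

(** The upper bound holds because [Fstar_mu] is nondecreasing with limit 1. *)
Lemma Fstar_mu_bounds l : 0 <= Fstar_mu mu G l <= 1.
Proof.
rewrite divr_ge0 ?(ltW m_gt0)//=; last first.
  by rewrite fine_ge0// expectation_ge0// => w; rewrite mulr_ge0.
apply: (cvgr_to_ge Fstar_mu_cvg1); exists l => // n /= ln.
exact: Fstar_mu_mono.
Qed.

(** On the conditioning event the neighbour mean divides by exactly [k], and off it both integrands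
    vanish. The result has the same shape as [annrE]. *)
Lemma annr_muE k : (0 < k)%N -> annr_mu mu G k =
  fine 'E_mu[fun w => nbr_sum k (Fstar_mu mu G) (G w)]%E /
  (k%:R * fine (mu (deg_event G k))).
Proof.
move=> k0; rewrite /annr_mu /cond_expectation invfM mulrA; congr (_ / _).
rewrite [RHS]mulrC -(@expectationZ_bounded _ _ _ _ _ (k%:R * 1)).
- congr (fine 'E_mu[_])%E; apply/funext => w.
  rewrite /nbr_mean /nbr_sum indicE mulrCA; have [dk|dk] := eqVneq (D w) k.
    by rewrite mem_set// mulr1 mul1r dk mulrC.
  by rewrite memNset ?mulr0 ?mul0r//; apply/eqP.
- by rewrite invr_ge0.
- exact: measurable_nbr_sum.
- by move=> w; apply: nbr_sum_bounds => // l; exact: Fstar_mu_bounds.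
Qed.

End limit_law.

Theorem theorem2p7 (R : realType)
  (* the graphs G_n, each on a probability space of its own *)
  (dn : nat -> measure_display)
  (Omega : forall n, measurableType (dn n))
  (P : forall n, probability (Omega n) R)
  (Gn : forall n, Omega n -> sgraph)
  (Gn_random : forall n, random_graph (Gn n))
  (Gn_finite : forall n, {ae P n, forall w,
     finite_set [set: Gn n w] /\ [set: Gn n w] !=set0})
  (Gn_ui : deg_unif_integrable P Gn)
  (* the limit (G, o) *)
  (d : measure_display) (T : measurableType d) (mu : probability T R)
  (G : T -> rooted_graph)
  (G_random : random_rooted_graph G)
  (G_connected : forall w, connected_graph (G w))
  (G_locfin : forall w, locally_finite (G w))
  (G_deg : (0 < mu [set w | (1 <= deg (groot (G w)))%N])%E)
  (G_cvg : local_cvg_in_prob P Gn mu G)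
  (k : nat) (k_ge1 : (1 <= k)%N) (k_pos : (0 < mu (deg_event G k))%E) :
  cvg_in_prob P (fun n w => annr R (Gn n w) k) (annr_mu mu G k).
Proof.
apply/cvg_in_probP; first by move=> n; exact: measurable_annr.
pose Gr (x : {n & Omega n}) := Gn (projT1 x) (projT2 x).
have fin : \forall x \near whp P, finite_graph (Gr x).
  move=> e e0; near=> n; have [B [mB PB BG]] := Gn_finite n.
  exists B; split => //; first by rewrite PB lee_fin ltW.
  by move=> w nB; apply: contrapT => nG; apply: nB; exact: BG.
(* Functions determined by the ball of radius 2 may be evaluated on the whole graph instead. *)
have loc phi (C : R) : iso_invariant phi -> (forall H, 0 <= phi H <= C) ->
    (forall (H : sgraph) (o : H), phi (gball 2 o) = phi (RootedGraph o)) ->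
    vavg (fun v : Gr x => phi (RootedGraph v)) @[x --> whp P] -->
    fine 'E_mu[fun w => phi (G w)]%E.
  move=> phi_iso phiC phi2.
  rewrite (_ : (fun w => _) = fun w => phi (gball 2 (groot (G w)))); last first.
    by apply/funext => w; rewrite phi2; case: (G w).
  rewrite (_ : (fun x => _) = fun x => vavg (fun v : Gr x => phi (gball 2 v))).
    apply: cvg_vavg_local phiC => // H.
    have [+ _] := cvg_in_probP P (fine (mu [set w |
      rooted_iso (gball 2 (groot (G w))) H]))
      (fun n => @measurable_ball_freq R _ _ _ (Gn_random n) 2 H).
    by apply; exact: G_cvg.
  by apply/funext => x; congr vavg; apply/funext => v; rewrite phi2.
have loc_deg (F : nat -> R) (C : R) : (forall l, 0 <= F l <= C) ->
    vavg (fun v : Gr x => F (deg v)) @[x --> whp P] -->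
    fine 'E_mu[fun w => F (deg (groot (G w)))]%E.
  move=> FC; apply: (loc _ C (@iso_invariant_deg R F)) => // H o.
  by rewrite deg_gball_root.
have loc_sum (F : nat -> R) : (forall l, 0 <= F l <= 1) ->
    vavg (fun v : Gr x => nbr_sum k F (RootedGraph v)) @[x --> whp P] -->
    fine 'E_mu[fun w => nbr_sum k F (G w)]%E.
  move=> FC; apply: loc (@iso_invariant_nbr_sum R k F) _ _.
    by move=> H; exact: nbr_sum_bounds.
  by move=> H o; rewrite nbr_sum_gball.
have mD := measurable_root_deg (R := R) G_random G_locfin.
have trunc_cvg l : vavg (fun v : Gr x => (deg v)%:R * (deg v <= l)%N%:R)
    @[x --> whp P] --> fine 'E_mu[fun w =>
      ((deg (groot (G w)))%:R * (deg (groot (G w)) <= l)%N%:R)%R]%E.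
  apply: (loc_deg (fun m => m%:R * (m <= l)%N%:R) l%:R) => m.
  by rewrite mulr_ge0//=; case: leqP => ml; rewrite ?mulr1 ?mulr0 ?ler0n ?ler_nat.
have m_fin := mean_deg_fin Gn_random Gn_ui fin mD trunc_cvg.
have m_cvg := cvg_mean_deg Gn_random Gn_ui fin mD trunc_cvg.
(* The degree dominates the indicator that it is at least 1, an event of positive probability. *)
have m_gt0 : 0 < fine 'E_mu[fun w => ((deg (groot (G w)))%:R)%R]%E.
  apply: fine_gt0; rewrite ltey_eq m_fin andbT (lt_le_trans G_deg)//.
  have mE := measurable_deg_set R G_random G_locfin [set l | (1 <= l)%N].
  rewrite -(expectation_indic mu mE); apply: expectation_mono => [||w|w] //.
  by rewrite indicE; case: (boolP (w \in _)) => [/set_mem/=|_];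
    rewrite ?ler1n ?ler0n.
have mk := measurable_deg_set R G_random G_locfin [set k].
have pk_gt0 : 0 < fine (mu (deg_event G k)).
  by rewrite fine_gt0// k_pos ltey_eq fin_num_measure.
have f_cvg : fdeg R (Gr x) k @[x --> whp P] --> fine (mu (deg_event G k)).
  rewrite (_ : fine _ = fine 'E_mu[fun w => ((deg (groot (G w)) == k)%:R)%R]%E).
    by apply: (loc_deg (fun l => (l == k)%:R) 1) => l; rewrite ler0n lern1 leq_b1.
  rewrite -(expectation_indic mu mk).
  congr (fine 'E_mu[_])%E; apply/funext => w; rewrite indicE.
  by congr (nat_of_bool _)%:R; apply/idP/eqP => [/set_mem//|?]; exact: mem_set.
have F_cvg l : Fstar R (Gr x) l @[x --> whp P] --> Fstar_mu mu G l.
  apply: (cvg_trans _ (_ : (vavg (fun v : Gr x => (deg v)%:R * (deg v <= l)%N%:R) /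
      vavg (fun v : Gr x => (deg v)%:R : R)) @[x --> whp P] --> _)).
    by apply: near_eq_cvg; near=> x; rewrite FstarE//; near: x; exact: fin.
  by apply: cvgM => //; apply: cvgV => //; rewrite gt_eqF.
have Fb := Fstar_mu_bounds G_random G_locfin m_fin m_gt0.
have F_unif e : 0 < e -> \forall x \near whp P, forall l,
    `|Fstar R (Gr x) l - Fstar_mu mu G l| <= e.
  apply: uniform_cdf_cvg => //.
  - near=> x; have fx : finite_graph (Gr x) by near: x; exact: fin.
    by split => [l n|l]; [exact: Fstar_mono|exact: Fstar_le1].
  - by move=> l n; exact: Fstar_mu_mono.
  - by move=> l; have /andP[] := Fb l.
  - exact: Fstar_mu_cvg1.
pose A (F : nat -> R) (x : {n & Omega n}) :=
  vavg (fun v : Gr x => nbr_sum k F (RootedGraph v)).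
have A_cvg : A (Fstar R (Gr x)) x @[x --> whp P] -->
    fine 'E_mu[fun w => nbr_sum k (Fstar_mu mu G) (G w)]%E.
  (* [Fstar R (Gr x)] depends on the whole graph and is not local, so it is first replaced by the
     deterministic [Fstar_mu]; the local limit applies to that term, and the difference tends to
     0. *)
  rewrite (_ : (fun x => A _ x) = fun x => A (Fstar_mu mu G) x +
    (A (Fstar R (Gr x)) x - A (Fstar_mu mu G) x)); last first.
    by apply/funext => x; rewrite addrC subrK.
  rewrite -[X in _ --> X]addr0; apply: cvgD; first exact: loc_sum.
  apply/cvgrPdist_le => e e0; near=> x.
  have fx : finite_graph (Gr x) by near: x; exact: fin.
  (* Each nonzero neighbour sum has [k] terms, so uniform accuracy [e / k] gives [e]. *)
  have Fx l : `|Fstar R (Gr x) l - Fstar_mu mu G l| <= e / k%:R.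
    by move: l; near: x; apply: F_unif; rewrite divr_gt0// ltr0n.
  have diff : A (Fstar R (Gr x)) x - A (Fstar_mu mu G) x =
    A (fun l => Fstar R (Gr x) l - Fstar_mu mu G l) x.
    rewrite /A -[in LHS](mulN1r (vavg _)) -vavgZ -vavgD//; congr vavg.
    by apply/funext => v; rewrite mulN1r nbr_sumB.
  rewrite sub0r normrN diff; apply: vavg_norm_le => // v.
  apply: le_trans (nbr_sum_norm_le _ k_ge1 Fx) _.
  by rewrite mulrC divfK// pnatr_eq0 -lt0n.
rewrite (annr_muE G_random G_locfin m_fin m_gt0 k_ge1).
apply: (cvg_trans _ (_ : (A (Fstar R (Gr x)) x / (k%:R * fdeg R (Gr x) k))
    @[x --> whp P] --> _)).
  (* The limits of the mean degree and of [fdeg] are positive, so both are positive with high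
     probability and the default value of [annr] is avoided. *)
  apply: near_eq_cvg; near=> x; rewrite annrE//.
  - by near: x; exact: fin.
  - by near: x; exact: cvgr_gt m_cvg _ m_gt0.
  - by near: x; exact: cvgr_gt f_cvg _ pk_gt0.
apply: cvgM => //; apply: cvgV; last exact: cvgMr.
by rewrite mulf_neq0 ?gt_eqF// ltr0n.
Unshelve. all: by end_near. Qed.
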